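(* Let $\boldsymbol{\epsilon}_\phi(\mathbf{x},t)$ be a noise-prediction network on $\mathbb{R}^d$, let $\alpha_t=\exp(-\int_0^t\beta(s)\,ds)$, $\sigma_t=\sqrt{(1-\alpha_t)/\alpha_t}$, and for a noisy observation $\mathbf{x}_t\in\mathbb{R}^d$ at time $t$ put $\tilde{\mathbf{x}}_t=\mathbf{x}_t/\sqrt{\alpha_t}$. The DDIM posterior mean estimate of the clean sample $\mathbf{x}_0$ conditioned on the noisy observation $\mathbf{x}_t$, given by $$\mathbb{E}[\mathbf{x}_0\mid\mathbf{x}_t]=\frac{\mathbf{x}_t-\sqrt{1-\alpha_t}\,\boldsymbol{\epsilon}_\phi(\mathbf{x}_t,t)}{\sqrt{\alpha_t}}=\tilde{\mathbf{x}}_t-\sigma_t\,\boldsymbol{\epsilon}_\phi(\mathbf{x}_t,t),$$ admits an interpretation as a single explicit (forward Euler) discretization step of the DDIM PF-ODE evaluated at $(\mathbf{x}_t,t)$, integrating along the reverse-time trajectory from $t$ to $0$.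
   Context: The variance-preserving forward diffusion is $d\mathbf{x}_t=-\tfrac12\beta_t\mathbf{x}_t\,dt+\sqrt{\beta_t}\,d\mathbf{W}_t$, where $\beta_t=\beta(t)$ is the noise schedule and $\mathbf{W}_t$ is standard Brownian motion, with transition $\mathbf{x}_t=\sqrt{\alpha_t}\,\mathbf{x}_0+\sqrt{1-\alpha_t}\,\boldsymbol{\epsilon}$, $\boldsymbol{\epsilon}\sim\mathcal{N}(0,I)$; equivalently $\tilde{\mathbf{x}}_t=\mathbf{x}_0+\sigma_t\boldsymbol{\epsilon}$. The network $\boldsymbol{\epsilon}_\phi$ is trained to predict the injected noise $\boldsymbol{\epsilon}$ by minimizing $\mathbb{E}_{\mathbf{x}_0,\boldsymbol{\epsilon},t}\big[\|\boldsymbol{\epsilon}-\boldsymbol{\epsilon}_\phi(\mathbf{x}_t,t)\|^2\big]$. The DDIM PF-ODE (the deterministic probability-flow ODE associated with this diffusion), expressed in the scaled variable $\tilde{\mathbf{x}}_t$, is $$\frac{d\tilde{\mathbf{x}}_t}{dt}=\boldsymbol{\epsilon}_\phi(\mathbf{x}_t,t)\,\frac{d\sigma_t}{dt},\qquad \mathbf{x}_t=\frac{\tilde{\mathbf{x}}_t}{\sqrt{1+\sigma_t^2}}.$$ *)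

(* Defs.v *)
From HB Require Import structures.
From mathcomp Require Import all_boot all_order all_algebra.
From mathcomp Require Import all_classical all_reals all_analysis.

Set Implicit Arguments.
Unset Strict Implicit.
Unset Printing Implicit Defensive.

Import Order.TTheory GRing.Theory Num.Theory.
Import numFieldNormedType.Exports.

Local Open Scope classical_set_scope.
Local Open Scope ring_scope.

Section schedule.
Context {R : realType}.
Variable beta : R -> R.

Definition alpha (t : R) : R :=
  expR (- \int[lebesgue_measure]_(s in `[0, t]) beta s).

Definition sigma (t : R) : R := Num.sqrt ((1 - alpha t) / alpha t).

(* A choice of the time as a function of the noise level. When [beta] vanishes
   on an interval, [sigma] is constant there and several times share a noise
   level; [t] is the one selected at the level [sigma t]. When [beta] is
   positive, [clock] is the inverse of [sigma] on [0, T]. *)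
Definition sigma_clock (T t : R) (clock : R -> R) : Prop :=
  [/\ {in `[0, sigma T], forall s, clock s \in `[0, T]},
      {in `[0, sigma T], forall s, sigma (clock s) = s} &
      clock (sigma t) = t].

End schedule.

Section ode.
Context {R : realType} {V : normedModType R}.

(* [y] satisfies the equation dy/ds = f s y at the point [s] *)
Definition solves_at (f : R -> V -> V) (y : R -> V) (s : R) : Prop :=
  is_derive s 1 y (f s (y s)).

Definition explicit_euler_step (f : R -> V -> V) (s s' : R) (y : V) : V :=
  y + (s' - s) *: f s y.

End ode.

Section ddim.
Context {R : realType} {d : nat}.
Variables (beta : R -> R) (eps : 'rV[R]_d -> R -> 'rV[R]_d).

(* DDIM PF-ODE in the scaled variable, the independent variable being the
   time [t] *)
Definition pf_ode (t : R) (y : 'rV[R]_d) : 'rV[R]_d :=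
  derive1 (sigma beta) t *: eps ((Num.sqrt (1 + sigma beta t ^+ 2))^-1 *: y) t.

(* The same equation, d y = eps d sigma, the independent variable being the
   noise level [s = sigma t] *)
Definition pf_ode_sigma (clock : R -> R) (s : R) (y : 'rV[R]_d) : 'rV[R]_d :=
  eps ((Num.sqrt (1 + s ^+ 2))^-1 *: y) (clock s).

Definition ddim_posterior_mean (x : 'rV[R]_d) (t : R) : 'rV[R]_d :=
  (Num.sqrt (alpha beta t))^-1 *:
    (x - Num.sqrt (1 - alpha beta t) *: eps x t).

End ddim.

Section random_vectors.
Context {R : realType} {d : nat}.

Definition coord {U : Type} (X : U -> 'rV[R]_d) (i : 'I_d) (u : U) : R :=
  X u 0 i.

(* sigma-algebra generated by [X]; for [X := id] it is the Borel
   sigma-algebra of R^d *)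
Definition sigma_of {U : Type} (X : U -> 'rV[R]_d) : set (set U) :=
  g_sigma_preimage (coord X).

Definition measurable_wrt {U : Type} (F : set (set U)) (X : U -> 'rV[R]_d) :=
  forall (i : 'I_d) (B : set R), measurable B -> F (coord X i @^-1` B).

Context {disp : measure_display} {Omega : measurableType disp}.
Variable P : probability Omega R.

Definition random_vector (X : Omega -> 'rV[R]_d) : Prop :=
  measurable_wrt measurable X.

Definition integrable_vector (X : Omega -> 'rV[R]_d) : Prop :=
  forall i : 'I_d, P.-integrable setT (EFin \o coord X i).

Definition independent_vectors (X Y : Omega -> 'rV[R]_d) : Prop :=
  forall A B, sigma_of X A -> sigma_of Y B ->
    P (A `&` B) = (P A * P B)%E.

Definition standard_gaussian (N : Omega -> 'rV[R]_d) : Prop :=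
  forall B : 'I_d -> set R, (forall i, measurable (B i)) ->
    P (\bigcap_(i in [set: 'I_d]) (coord N i @^-1` B i)) =
    (\prod_(i < d) normal_prob (0 : R) 1 (B i))%E.

(* [Z] is a version of the conditional expectation of [Y] given [X] *)
Definition is_cond_expectation (Y X Z : Omega -> 'rV[R]_d) : Prop :=
  [/\ measurable_wrt (sigma_of X) Z,
      integrable_vector Z &
      forall (i : 'I_d) (A : set Omega), sigma_of X A ->
        \int[P]_(w in A) (coord Z i w)%:E = \int[P]_(w in A) (coord Y i w)%:E]%E.

Definition noise_loss (X N : Omega -> 'rV[R]_d) (f : 'rV[R]_d -> 'rV[R]_d) :
    \bar R :=
  (\int[P]_w (\sum_(i < d) (N w 0 i - f (X w) 0 i) ^+ 2)%:E)%E.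

Definition noise_loss_minimizer (X N : Omega -> 'rV[R]_d)
    (f : 'rV[R]_d -> 'rV[R]_d) : Prop :=
  measurable_wrt (sigma_of id) f /\
  forall g, measurable_wrt (sigma_of id) g ->
    (noise_loss X N f <= noise_loss X N g)%E.

End random_vectors.

(* Main.v *)
(** Writing B(t) for the integral of beta over [0, t], one has
    sigma = sqrt (exp B - 1) and 1 + sigma^2 = 1 / alpha, which gives the two
    algebraic identities. Taking sigma as independent variable turns the PF-ODE
    into dy/dsigma = eps, whose Euler step of length 0 - sigma_t from the scaled
    observation is the posterior mean. The change of variable is the chain rule:
    where beta is positive the clock is a local inverse of sigma, and if the
    clock returns a time other than u at the level sigma(u), then sigma is flat
    next to u and both sides of the equation at u vanish. For the conditional
    expectation, the first-order optimality of the network among measurable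
    functions of x_t makes the residual of the noise orthogonal to the
    sigma-algebra of x_t, and x_0 minus the posterior mean is a multiple of that
    residual. *)
From Pilot Require Import Defs.
From HB Require Import structures.
From mathcomp Require Import all_boot all_order all_algebra.
From mathcomp Require Import all_classical all_reals all_analysis.
From mathcomp Require Import measurable_realfun ring lra.

Set Implicit Arguments.
Unset Strict Implicit.
Unset Printing Implicit Defensive.

Import Order.TTheory GRing.Theory Num.Theory.
Import numFieldNormedType.Exports.

Local Open Scope classical_set_scope.
Local Open Scope ring_scope.

(** * Chain rule for a curve in a normed space *)

Section chain_rule.
Context {R : realType} {V : normedModType R}.

(** The differential of [f] at [g x] is linear, so its value at [b] is [b] times its value at 1. *)
Lemma is_derive_scale_comp (f : R -> V) (g : R -> R) (x b : R) (v : V) :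
  is_derive (g x) 1 f v -> is_derive x 1 g b ->
  is_derive x 1 (f \o g) (b *: v).
Proof.
move=> [df <-] [dg <-].
move/derivable1_diffP : (df) => dif; move/derivable1_diffP : (dg) => dig.
have dfg : differentiable (f \o g) x by exact: differentiable_comp.
apply: DeriveDef; first exact/derivable1_diffP.
rewrite (deriveE _ dfg) diff_comp// (deriveE _ dif) (deriveE _ dig) /=.
by rewrite -[X in 'd f _ X = _]mulr1 -[X in _ = X]linearZ.
Qed.

End chain_rule.

(** * Derivative at the end of a segment of constancy *)

Section flat.
Context {R : realType}.

(** Carathéodory's form [f z - f a = g z * (z - a)], with [g] continuous at [a] and [g a = l], makes
    [g] vanish on the segment except possibly at [a]; continuity then gives [g a = 0]. *)
Lemma derive_eq0_flat (f : R -> R) (a b l : R) : a != b ->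
  (forall z, Num.min a b <= z <= Num.max a b -> f z = f a) ->
  is_derive a 1 f l -> l = 0.
Proof.
move=> ab fE /is_derive1_caratheodory[g [gE gc <-]].
(* Moving from [a] towards [b] with parameter [e] treats both orders of [a] and [b] by a single
   right limit at 0. *)
pose h e : R := g (a + e * (b - a)).
have h0 e : 0 < e <= 1 -> h e = 0.
  move=> /andP[e0 e1]; rewrite /h; set z := a + _.
  have zE : f z = f a.
    apply: fE; rewrite /z; case: (leP a b) => // [lab|lba]; apply/andP; split; nra.
  have := gE z; rewrite zE subrr => /esym/eqP; rewrite mulf_eq0 => /orP[/eqP//|].
  by rewrite /z addrAC subrr add0r mulf_eq0 (gt_eqF e0) subr_eq0 eq_sym (negbTE ab).
have hc : h e @[e --> 0^'+] --> g a.
  apply: cvg_at_right_filter.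
  apply: continuous_cvg; first exact: gc.
  rewrite -[X in _ --> X](addr0 a) -[X in a + X](mul0r (b - a)).
  by apply: cvgD; [exact: cvg_cst|apply: cvgMl; exact: cvg_id].
apply: (cvg_unique _ hc); first exact: Rhausdorff.
apply: cvg_near_cst; near=> e; apply: h0; apply/andP; split => //.
by near: e; apply: nbhs_right_le.
Unshelve. all: by end_near. Qed.

Lemma derive_eq0_homo (f : R -> R) (i : interval R) (u v l : R) :
  {in i &, {homo f : x y / x <= y}} -> u \in i -> v \in i ->
  u != v -> f v = f u -> is_derive u 1 f l -> l = 0.
Proof.
move=> fi ui vi uv vu; apply: derive_eq0_flat uv _ => z uzv.
have zi : z \in i.
  move: uzv; case: (leP u v) => _ /andP[uz zv].
    by apply: (interval_is_interval ui vi); rewrite uz.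
  by apply: (interval_is_interval vi ui); rewrite uz.
move: uzv; case: (leP u v) => _ /andP[uz zv]; apply: le_anti.
  by rewrite -{1}vu !fi.
by rewrite -{2}vu !fi.
Qed.

End flat.

(** * The noise level as a function of time *)

Section schedule_theory.
Context {R : realType}.
Variables (T : R) (beta : R -> R).
Hypothesis T_gt0 : 0 < T.
Hypothesis beta_cont : {within `[0, T], continuous beta}.
Hypothesis beta_ge0 : {in `[0, T], forall s, 0 <= beta s}.
Implicit Types u v s t : R.

Local Notation mu := (@lebesgue_measure R).
Local Notation B := (fun t => \int[mu]_(s in `[0, t]) beta s).

Lemma integrable_schedule : mu.-integrable `[0, T] (EFin \o beta).
Proof. by apply: continuous_compact_integrable => //; exact: segment_compact. Qed.

Lemma integral_schedule_ge0 u : u \in `[0, T] -> 0 <= B u.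
Proof.
rewrite in_itv/= => /andP[u0 uT]; apply: Rintegral_ge0 => s /=.
rewrite in_itv/= => /andP[s0 su]; apply: beta_ge0.
by rewrite in_itv/= s0 (le_trans su).
Qed.

Lemma integral_schedule_le u v : u \in `[0, T] -> v \in `[0, T] -> u <= v ->
  B u <= B v.
Proof.
rewrite !in_itv/= => /andP[u0 uT] /andP[v0 vT] uv.
rewrite -subr_ge0 Rintegral_itvB.
- apply: Rintegral_ge0 => s /=; rewrite in_itv/= => /andP[us sv].
  by apply: beta_ge0; rewrite in_itv/= (le_trans sv)// (le_trans u0)// ltW.
- apply: integrableS integrable_schedule => //.
  by apply: subset_itvl; rewrite bnd_simp.
- by rewrite bnd_simp.
- by rewrite bnd_simp.
Qed.

Lemma integral_schedule_continuous : {within `[0, T], continuous B}.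
Proof.
exact: (parameterized_integral_continuous (ltW T_gt0) integrable_schedule).
Qed.

Lemma schedule_continuous_at u : u \in `]0, T[ -> {for u, continuous beta}.
Proof.
by move=> uT; have [+ _ _] := (continuous_within_itvP _ T_gt0).1 beta_cont; exact.
Qed.

Lemma is_derive_integral_schedule u : u \in `]0, T[ -> is_derive u 1 B (beta u).
Proof.
move=> /[dup] uT; rewrite in_itv/= => /andP[u0 ultT].
have [dB BE] := continuous_FTC1_closed ultT integrable_schedule u0
  (schedule_continuous_at uT).
by apply: DeriveDef; [exact: dB|rewrite -derive1E; exact: BE].
Qed.

Lemma alpha_gt0 u : 0 < alpha beta u.
Proof. exact: expR_gt0. Qed.

Lemma alpha_le1 u : u \in `[0, T] -> alpha beta u <= 1.
Proof. by move=> /integral_schedule_ge0 ?; rewrite /alpha -expR0 ler_expR oppr_le0. Qed.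

Lemma sigmaE u : sigma beta u = Num.sqrt (expR (B u) - 1).
Proof.
rewrite /sigma mulrBl divff ?gt_eqF ?alpha_gt0// mul1r /alpha.
by rewrite expRN invrK.
Qed.

Lemma sigma_sqr u : u \in `[0, T] -> sigma beta u ^+ 2 = expR (B u) - 1.
Proof.
move=> /integral_schedule_ge0 B0.
by rewrite sigmaE sqr_sqrtr// subr_ge0 -expR0 ler_expR.
Qed.

Lemma sqrt_1Dsigma_sqr u : u \in `[0, T] ->
  Num.sqrt (1 + sigma beta u ^+ 2) = (Num.sqrt (alpha beta u))^-1.
Proof.
move=> uT; rewrite sigma_sqr// addrC subrK /alpha expRN sqrtrV ?expR_ge0//.
by rewrite invrK.
Qed.

Lemma sigma_alphaE u : u \in `[0, T] ->
  sigma beta u = (Num.sqrt (alpha beta u))^-1 * Num.sqrt (1 - alpha beta u).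
Proof.
move=> uT; rewrite /sigma sqrtrM ?subr_ge0 ?alpha_le1// mulrC.
by rewrite sqrtrV// ltW ?alpha_gt0.
Qed.

Lemma sigma_ge0 u : 0 <= sigma beta u.
Proof. exact: sqrtr_ge0. Qed.

Lemma sigma0 : sigma beta 0 = 0.
Proof. by rewrite sigmaE set_itv1 Rintegral_set1 expR0 subrr sqrtr0. Qed.

Lemma sigma_le : {in `[0, T] &, {homo sigma beta : u v / u <= v}}.
Proof.
move=> u v uT vT uv; rewrite !sigmaE; apply: ler_wsqrtr.
by rewrite lerD2r ler_expR; exact: integral_schedule_le.
Qed.

Lemma sigma_continuous : {within `[0, T], continuous (sigma beta)}.
Proof.
have -> : sigma beta = (fun b : R => Num.sqrt (expR b - 1)) \o B.
  by apply/funext => u; rewrite sigmaE.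
move=> u; apply: (@continuous_comp (subspace `[0, T]) R R B
  (fun b : R => Num.sqrt (expR b - 1)) u).
  exact: integral_schedule_continuous.
apply: (@continuous_comp _ _ _ (fun b : R => expR b - 1) (@Num.sqrt R)).
  by apply: cvgB; [exact: continuous_expR|exact: cvg_cst].
exact: sqrt_continuous.
Qed.

Lemma sigma_surj s : s \in `[0, sigma beta T] ->
  exists2 u, u \in `[0, T] & sigma beta u = s.
Proof.
move=> sT; apply: (IVT (ltW T_gt0) sigma_continuous).
by rewrite sigma0 min_l ?max_r ?sigma_ge0//; move: sT; rewrite in_itv.
Qed.

(** A positive noise level keeps [expR (B u) - 1] away from 0, where the square root is not
    differentiable. *)
Lemma is_derive_sigma_expR u : u \in `]0, T[ -> 0 < sigma beta u ->
  is_derive u 1 (sigma beta) (expR (B u) * beta u / (2 * sigma beta u)).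
Proof.
move=> uT su.
have -> : sigma beta = (fun b : R => Num.sqrt (expR b - 1)) \o B.
  by apply/funext => v; rewrite sigmaE.
have dB := is_derive_integral_schedule uT.
have eB : 0 < expR (B u) - 1.
  by rewrite -sigma_sqr ?exprn_gt0//; exact: subset_itv_oo_cc.
have de : is_derive (B u) 1 (fun b : R => expR b - 1) (expR (B u)).
  by rewrite -[X in is_derive _ _ _ X]subr0; apply: is_deriveB.
have ds : is_derive (expR (B u) - 1) 1 (@Num.sqrt R)
    (2 * Num.sqrt (expR (B u) - 1))^-1 by exact: is_derive1_sqrt.
have dse := @is_derive1_comp _ (@Num.sqrt R) (fun b : R => expR b - 1) _ _ _ ds de.
apply: (is_derive_eq (is_derive1_comp dse dB)).
by rewrite /= -mulrA mulrC.
Qed.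

Lemma is_derive_sigma u : u \in `]0, T[ -> 0 < sigma beta u ->
  is_derive u 1 (sigma beta) (derive1 (sigma beta) u).
Proof.
move=> uT su; have [ds _] := is_derive_sigma_expR uT su.
by apply: DeriveDef; [exact: ds|rewrite derive1E].
Qed.

(** The derivative is [beta u] times a positive factor. *)
Lemma derive1_sigma_eq0 u : u \in `]0, T[ -> 0 < sigma beta u ->
  (derive1 (sigma beta) u == 0) = (beta u == 0).
Proof.
move=> uT su; have [_] := is_derive_sigma_expR uT su; rewrite -derive1E => ->.
rewrite mulf_eq0 invr_eq0 mulf_eq0 (gt_eqF (expR_gt0 _)) mulf_eq0.
by rewrite (gt_eqF su) pnatr_eq0 /= orbF.
Qed.

(* [sigma] is monotone, so it would be constant between two distinct times of
   the same noise level, and its derivative at [u] would vanish. *)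
Lemma sigma_level_inj u v : u \in `]0, T[ -> v \in `[0, T] ->
  0 < sigma beta u -> 0 < beta u -> sigma beta v = sigma beta u -> v = u.
Proof.
move=> uT vT su bu vu; apply/eqP/negPn/negP => v_neq_u.
have uTc : u \in `[0, T] by exact: subset_itv_oo_cc.
have uv : u != v by rewrite eq_sym.
have /eqP := derive_eq0_homo sigma_le uTc vT uv vu (is_derive_sigma uT su).
by rewrite (derive1_sigma_eq0 uT su) (gt_eqF bu).
Qed.

Lemma sigma_clock_exists t : t \in `[0, T] -> exists c, sigma_clock beta T t c.
Proof.
move=> tT.
have /choice[c cP] : forall s, exists u, s \in `[0, sigma beta T] ->
    u \in `[0, T] /\ sigma beta u = s.
  move=> s; have [sT|] := boolP (s \in `[0, sigma beta T]); last by exists 0.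
  by have [u uT us] := sigma_surj sT; exists u.
(* The intermediate value theorem may select another time of the same level as [t], so the choice is
   overridden at that level. *)
exists (fun s => if s == sigma beta t then t else c s); split => [s sT|s sT|].
- by case: ifPn => // _; exact: (cP _ sT).1.
- by case: ifPn => [/eqP//|_]; exact: (cP _ sT).2.
- by rewrite eqxx.
Qed.

(** * The PF-ODE in time and in noise level *)

Section pf_ode_change_of_variable.
Context {d : nat}.
Variables (eps : 'rV[R]_d -> R -> 'rV[R]_d) (t : R) (clock : R -> R).
Hypothesis clockP : sigma_clock beta T t clock.

Lemma sigma_itv u : u \in `[0, T] -> sigma beta u \in `[0, sigma beta T].
Proof.
move=> uT; rewrite in_itv/= sigma_ge0 sigma_le//.
  by rewrite in_itv/= lexx ltW.
by move: uT; rewrite in_itv/= => /andP[].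
Qed.

Lemma pf_ode_of_sigma (y : R -> 'rV[R]_d) u : u \in `]0, T[ ->
  0 < sigma beta u ->
  solves_at (pf_ode_sigma eps clock) y (sigma beta u) ->
  solves_at (pf_ode beta eps) (y \o sigma beta) u.
Proof.
move=> uT su; rewrite /solves_at /pf_ode_sigma /pf_ode /=.
move=> /is_derive_scale_comp/(_ (is_derive_sigma uT su)).
have [clockT clockK _] := clockP.
have uTc : u \in `[0, T] by exact: subset_itv_oo_cc.
have [->|] := eqVneq (clock (sigma beta u)) u; first by [].
move=> /eqP clock_neq.
(* The network is evaluated at two different times, so the two sides are matched through a zero
   factor; [beta u > 0] would make [u] the only time of its level. *)
suff /eqP -> : derive1 (sigma beta) u == 0 by rewrite !scale0r.
rewrite (derive1_sigma_eq0 uT su).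
rewrite eq_le (beta_ge0 uTc) andbT leNgt; apply/negP => bu.
apply: clock_neq; have su' := sigma_itv uTc.
exact: sigma_level_inj uT (clockT _ su') su bu (clockK _ su').
Qed.

(** At the end points of the time interval [sigma] takes the two excluded levels. *)
Lemma clock_itvoo s : s \in `]0, sigma beta T[ -> clock s \in `]0, T[.
Proof.
have [clockT clockK _] := clockP.
move=> sT; have sTc : s \in `[0, sigma beta T] by exact: subset_itv_oo_cc.
have := clockK _ sTc; have := clockT _ sTc; move: sT; rewrite !in_itv/=.
move=> /andP[s0 sT] /andP[c0 cT] cs; rewrite !lt_neqAle c0 cT !andbT.
apply/andP; split.
  by apply/eqP => cE; move: s0; rewrite -cs -cE sigma0 ltxx.
by apply/eqP => cE; move: sT; rewrite -cs cE ltxx.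
Qed.

(** Inverse function rule for [sigma] at [clock s], where its slope is nonzero because [beta] is
    positive there. *)
Lemma is_derive_clock s : s \in `]0, sigma beta T[ -> 0 < beta (clock s) ->
  is_derive s 1 clock (derive1 (sigma beta) (clock s))^-1.
Proof.
have [clockT clockK _] := clockP.
move=> sT bs; have sTc : s \in `[0, sigma beta T] by exact: subset_itv_oo_cc.
have cs := clockK _ sTc; have cT := clock_itvoo sT.
set c := clock s in cs cT bs *.
have sc0 : 0 < sigma beta c by rewrite cs; move: sT; rewrite in_itv/= => /andP[].
have dsc := is_derive_sigma cT sc0.
have sC : {near c, continuous (sigma beta)}.
  near=> z; have zT : z \in `]0, T[ by near: z; exact: near_in_itvoo.
  by have [+ _ _] := (continuous_within_itvP _ T_gt0).1 sigma_continuous; exact.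
rewrite -[X in is_derive X]cs.
apply: (is_derive_inverse _ sC dsc); last first.
  by rewrite (derive1_sigma_eq0 cT sc0) (gt_eqF bs).
(* [clock] must undo [sigma] on a whole neighbourhood of [c]: [beta] and [sigma] stay positive there
   by continuity, so each level has a single time. *)
near=> z; have zT : z \in `]0, T[ by near: z; exact: near_in_itvoo.
have zTc : z \in `[0, T] by exact: subset_itv_oo_cc.
have sz := sigma_itv zTc.
have sz0 : 0 < sigma beta z.
  by near: z; exact: (cvgr_gt _ (nbhs_singleton sC)).
have bz : 0 < beta z.
  by near: z; exact: (cvgr_gt _ (schedule_continuous_at cT)).
exact: sigma_level_inj zT (clockT _ sz) sz0 bz (clockK _ sz).
Unshelve. all: by end_near. Qed.

(** The slope of [sigma] in the PF-ODE cancels against the derivative of [clock], which is its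
    inverse. *)
Lemma pf_ode_to_sigma (y : R -> 'rV[R]_d) s : s \in `]0, sigma beta T[ ->
  0 < beta (clock s) -> solves_at (pf_ode beta eps) y (clock s) ->
  solves_at (pf_ode_sigma eps clock) (y \o clock) s.
Proof.
move=> sT bs; have [clockT clockK _] := clockP.
have sTc : s \in `[0, sigma beta T] by exact: subset_itv_oo_cc.
have cs := clockK _ sTc.
rewrite /solves_at /pf_ode /pf_ode_sigma.
move=> /is_derive_scale_comp/(_ (is_derive_clock sT bs)).
have sc0 : 0 < sigma beta (clock s).
  by rewrite cs; move: sT; rewrite in_itv/= => /andP[].
rewrite scalerA mulVf ?scale1r ?cs//.
by rewrite (derive1_sigma_eq0 (clock_itvoo sT) sc0) (gt_eqF bs).
Qed.

End pf_ode_change_of_variable.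

End schedule_theory.
(* [coord] would otherwise denote the coordinates of [vector.v]. *)
Local Notation coord := Pilot.Defs.coord.

(** * Sigma-algebra generated by a random vector *)

Section generated_sigma_algebra.
Context {R : realType} {d : nat}.

(** Used to write the indicator of an event of [sigma_of X] as a Borel function of [X]. *)
Lemma sigma_ofE {U : Type} (X : U -> 'rV[R]_d) :
  sigma_of X = preimage_set_system setT X (sigma_of id).
Proof. exact: (g_sigma_preimage_comp (coord id) X). Qed.

Lemma measurable_wrt_comp {U : Type} (X : U -> 'rV[R]_d)
    (f : 'rV[R]_d -> 'rV[R]_d) :
  measurable_wrt (sigma_of id) f -> measurable_wrt (sigma_of X) (f \o X).
Proof.
move=> mf i B mB; rewrite sigma_ofE; exists (coord f i @^-1` B); first exact: mf.
by rewrite setTI.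
Qed.

Lemma measurable_wrt_gen {U : Type} (X : U -> 'rV[R]_d) :
  measurable_wrt (sigma_of X) X.
Proof.
move=> i B mB; apply: sub_gen_smallest; rewrite (bigD1 i)//=; left.
by exists B => //; rewrite setTI.
Qed.

Lemma sub_sigma_of {disp} {Omega : measurableType disp} (X : Omega -> 'rV[R]_d) :
  random_vector X -> sigma_of X `<=` measurable.
Proof.
move=> mX; apply: smallest_sub; first exact: sigma_algebra_measurable.
apply: (big_ind (fun G => G `<=` measurable)) => // [G H mG mH A [/mG|/mH]//|].
by move=> i _ _ [B mB <-]; rewrite setTI; exact: mX.
Qed.

(* Reduces measurability with respect to [sigma_of X] to the library's notion,
   on the measurable space [U] endowed with [sigma_of X]. *)
Lemma measurable_wrtP {U : pointedType} (X Z : U -> 'rV[R]_d) :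
  measurable_wrt (sigma_of X) Z <->
  forall i : 'I_d, measurable_fun setT (coord Z i :
    g_sigma_algebraType (\big[setU/set0]_(i < d)
      preimage_set_system setT (coord X i) measurable) -> R).
Proof.
split=> [mZ i _ B mB|mZ i B mB]; first by rewrite setTI; exact: mZ.
by rewrite -[_ @^-1` _]setTI; exact: mZ.
Qed.

Lemma random_vectorP {disp} {Omega : measurableType disp} (X : Omega -> 'rV[R]_d) :
  random_vector X <-> forall i : 'I_d, measurable_fun setT (coord X i).
Proof.
split=> [mX i _ B mB|mX i B mB]; first by rewrite setTI; exact: mX.
by rewrite -[_ @^-1` _]setTI; exact: mX.
Qed.

End generated_sigma_algebra.

(** * Finite second moment of the normal law *)

Section gaussian_second_moment.
Context {R : realType}.
Local Notation mu := (@lebesgue_measure R).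
Local Open Scope ereal_scope.

(** The Radon-Nikodym derivative of [normal_prob] and [normal_pdf] have the same integral over every
    measurable set, hence agree almost everywhere. *)
Lemma ge0_integral_normal_prob (m s : R) (f : R -> \bar R) :
  measurable_fun setT f -> (forall x, 0 <= f x) ->
  \int[normal_prob m s]_x f x = \int[mu]_x (f x * (normal_pdf m s x)%:E).
Proof.
move=> mf f0; pose nu : {finite_measure set _ -> \bar R} := normal_prob m s.
have numu : nu `<< mu by exact: normal_prob_dominates.
rewrite -(Radon_Nikodym_SigmaFinite.change_of_variables numu f0 measurableT mf).
apply: ae_eq_integral => //.
- apply: emeasurable_funM => //.
  exact: measurable_int (Radon_Nikodym_SigmaFinite.f_integrable numu).
- apply: emeasurable_funM => //; apply/measurable_EFinP.
  exact: measurable_normal_pdf.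
- apply: ae_eqe_mul2l; apply: integral_ae_eq => //.
  + exact: Radon_Nikodym_SigmaFinite.f_integrable.
  + by apply/measurable_EFinP; exact: measurable_normal_pdf.
  + by move=> E _ mE; rewrite -Radon_Nikodym_SigmaFinite.f_integral.
Qed.

(** With [y = x ^+ 2 / 4], the integrand is proportional to [y * expR (- y) * expR (- y)]; since
    [y * expR (- y) <= 1], a multiple of the normal density of variance 2 dominates it. *)
Lemma normal_second_moment_lty :
  \int[normal_prob (0 : R) 1]_x (x ^+ 2)%:E < +oo.
Proof.
rewrite ge0_integral_normal_prob; last 2 first.
- by apply/measurable_EFinP; exact: measurable_funX.
- by move=> x; rewrite lee_fin sqr_ge0.
pose s : R := Num.sqrt 2; have s0 : s != 0%R by rewrite gt_eqF// sqrtr_gt0.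
have p0 : (0 < normal_peak s)%R by exact: normal_peak_gt0.
(* The 4 comes from [x ^+ 2 = 4 * y]; the quotient exchanges the normalising constants of the two
   densities. *)
pose C : R := (4 * normal_peak 1 / normal_peak s)%R.
have C0 : (0 <= C)%R by rewrite divr_ge0 ?mulr_ge0 ?normal_peak_ge0.
apply: (@le_lt_trans _ _ (\int[mu]_x (C%:E * (normal_pdf 0 s x)%:E))); last first.
  rewrite integralZl//; last exact: integrable_normal_pdf.
  by rewrite integral_normal_pdf mule1 ltry.
apply: ge0_le_integral => //.
- by move=> x _; apply: mule_ge0; rewrite lee_fin ?sqr_ge0 ?normal_pdf_ge0.
- apply: emeasurable_funM; apply/measurable_EFinP; first exact: measurable_funX.
  exact: measurable_normal_pdf.
- apply: emeasurable_funM => //; apply/measurable_EFinP.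
  exact: measurable_normal_pdf.
- move=> x _; rewrite -!EFinM lee_fin !normal_pdfE ?oner_eq0//.
  rewrite /normal_fun subr0 expr1n sqr_sqrtr// /C.
  rewrite [leRHS]mulrA divfK ?gt_eqF//.
  set y := (x ^+ 2 / 4)%R.
  have -> : (- x ^+ 2 / (1 *+ 2) = - y - y)%R by rewrite /y; field.
  have -> : (- x ^+ 2 / (2 *+ 2) = - y)%R by rewrite /y; field.
  have -> : (x ^+ 2 = 4 * y)%R by rewrite /y; field.
  rewrite expRD.
  have yexp : (y * expR (- y) <= 1)%R.
    rewrite expRN ler_pdivrMr ?expR_gt0// mul1r.
    by apply: le_trans (expR_ge1Dx y); rewrite lerDr.
  have p1 : (0 <= normal_peak (1 : R))%R by exact: normal_peak_ge0.
  have -> : (4 * y * (normal_peak 1 * (expR (- y) * expR (- y))) =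
    4 * normal_peak 1 * expR (- y) * (y * expR (- y)))%R by ring.
  by rewrite ler_piMr// !mulr_ge0 ?expR_ge0.
Qed.

End gaussian_second_moment.

(** * Coordinates of a standard Gaussian vector *)

Section standard_gaussian.
Context {R : realType} {d : nat} {disp : measure_display}.
Context {Omega : measurableType disp} (P : probability Omega R).

Lemma standard_gaussian_marginal (N : Omega -> 'rV[R]_d) (i : 'I_d) (B : set R) :
  standard_gaussian P N -> measurable B ->
  P (coord N i @^-1` B) = normal_prob (0 : R) 1 B.
Proof.
(* The other coordinates are left free and contribute factors 1 to the product. *)
move=> gN mB; pose C j := if j == i then B else [set: R].
have -> : coord N i @^-1` B = \bigcap_(j in [set: 'I_d]) (coord N j @^-1` C j).
  apply/seteqP; split=> w /=.
    by move=> Bw j _; rewrite /C; case: eqP => [->|].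
  by move=> /(_ i I); rewrite /C eqxx.
rewrite gN; last by move=> j; rewrite /C; case: ifP.
rewrite (bigD1 i)//= {1}/C eqxx big1 ?mule1// => j /negbTE ji.
by rewrite /C ji -[RHS](@probability_setT _ _ _ (normal_prob (0 : R) 1)).
Qed.

Lemma standard_gaussian_sqr_integrable (N : Omega -> 'rV[R]_d) (i : 'I_d) :
  random_vector N -> standard_gaussian P N ->
  P.-integrable setT (EFin \o (fun w => coord N i w ^+ 2)).
Proof.
move=> /random_vectorP/(_ i) mN gN; apply/integrableP; split.
  by apply/measurable_EFinP; exact: measurable_funX.
have mN' : measurable_fun setT (coord N i : Omega -> measurableTypeR R) by [].
pose M : {mfun Omega >-> measurableTypeR R} :=
  HB.pack (coord N i : Omega -> measurableTypeR R)
    (isMeasurableFun.Build _ _ _ _ _ mN').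
have mx2 : measurable_fun setT (fun x : R => (x ^+ 2)%:E).
  by apply/measurable_EFinP; exact: measurable_funX.
have x20 x : (0 <= (x ^+ 2)%:E :> \bar R)%E by rewrite lee_fin sqr_ge0.
apply: le_lt_trans (@normal_second_moment_lty R); rewrite le_eqVlt.
apply/orP; left; apply/eqP.
transitivity (\int[distribution P M]_x (x ^+ 2)%:E)%E.
  rewrite (ge0_integral_distribution M mx2 x20).
  by apply: eq_integral => w _ /=; rewrite ger0_norm ?sqr_ge0.
apply: eq_measure_integral => B mB _.
exact: standard_gaussian_marginal.
Qed.

End standard_gaussian.

(** * Optimality of the trained network *)

Section noise_prediction.
Context {R : realType} {d : nat} {disp : measure_display}.
Context {Omega : measurableType disp} (P : probability Omega R).
Implicit Types (X N : Omega -> 'rV[R]_d) (f : 'rV[R]_d -> 'rV[R]_d).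

(** The bound [|D| <= 1 + D ^+ 2] and the finiteness of [P] give the domination. *)
Lemma square_integrable_integrable (D : Omega -> R) :
  measurable_fun setT D -> P.-integrable setT (EFin \o (fun w => D w ^+ 2)) ->
  P.-integrable setT (EFin \o D).
Proof.
move=> mD iD; apply: (@le_integrable _ _ _ _ _ _ _
    (EFin \o (fun w => 1 + D w ^+ 2))) => //.
- exact/measurable_EFinP.
- move=> w _ /=; rewrite lee_fin [leRHS]ger0_norm ?addr_ge0 ?sqr_ge0//.
  rewrite -(real_normK (num_real (D w))).
  by have := sqr_ge0 (`|D w| - 1); have := normr_ge0 (D w); nra.
- have -> : EFin \o (fun w => 1 + D w ^+ 2) =
      ((fun=> 1%:E) \+ (EFin \o (fun w => D w ^+ 2)%R))%E by [].
  by apply: integrableD => //; exact: finite_measure_integrable_cst.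
Qed.

Lemma random_vector_residual X N f :
  random_vector X -> random_vector N -> measurable_wrt (sigma_of id) f ->
  forall i, measurable_fun setT (fun w => N w 0 i - f (X w) 0 i).
Proof.
move=> mX /random_vectorP mN mf i; apply: measurable_funB; first exact: mN.
have /random_vectorP : random_vector (f \o X); last exact.
by move=> j B mB; apply: (sub_sigma_of mX); exact: measurable_wrt_comp.
Qed.

Lemma EFin_Rintegral (h : Omega -> R) : P.-integrable setT (EFin \o h) ->
  (\int[P]_w (h w)%:E)%E = (\int[P]_w h w)%:E.
Proof. by move=> hi; rewrite /Rintegral fineK//; exact: integrable_fin_num. Qed.

(** The zero network is a competitor, and its loss is the sum of the second moments of the noise. *)
Lemma noise_loss_lty X N f : random_vector X -> random_vector N ->
  standard_gaussian P N -> noise_loss_minimizer P X N f ->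
  (noise_loss P X N f < +oo)%E.
Proof.
move=> mX mN gN [_ /(_ (fun=> 0))] f_min.
have m0 : measurable_wrt (sigma_of id) (fun _ : 'rV[R]_d => 0 : 'rV[R]_d).
  by apply/measurable_wrtP => i; exact: measurable_cst.
apply: le_lt_trans (f_min m0) _; rewrite /noise_loss.
have : P.-integrable setT (fun w => \sum_(i < d) (coord N i w ^+ 2)%:E)%E.
  by apply: integrable_sum => // i _; exact: standard_gaussian_sqr_integrable.
move=> /integrableP[_]; apply: le_lt_trans.
rewrite le_eqVlt; apply/orP; left; apply/eqP; apply: eq_integral => w _.
rewrite sumEFin gee0_abs ?lee_fin ?sumr_ge0// => [|i _]; last exact: sqr_ge0.
by congr EFin; apply: eq_bigr => i _; rewrite mxE subr0.
Qed.

Lemma residual_sqr_integrable X N f : random_vector X -> random_vector N ->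
  measurable_wrt (sigma_of id) f -> (noise_loss P X N f < +oo)%E ->
  P.-integrable setT
    (EFin \o (fun w => \sum_(i < d) (N w 0 i - f (X w) 0 i) ^+ 2)).
Proof.
move=> mX mN mf loss; apply/integrableP; split.
  apply/measurable_EFinP; apply: measurable_sum => i.
  by apply: measurable_funX; exact: random_vector_residual.
apply: le_lt_trans loss; rewrite le_eqVlt; apply/orP; left; apply/eqP.
apply: eq_integral => w _ /=; rewrite ger0_norm// sumr_ge0// => i _.
exact: sqr_ge0.
Qed.

Lemma residual_integrable X N f i : random_vector X -> random_vector N ->
  measurable_wrt (sigma_of id) f -> (noise_loss P X N f < +oo)%E ->
  P.-integrable setT (EFin \o (fun w => N w 0 i - f (X w) 0 i)).
Proof.
move=> mX mN mf loss; have mD := random_vector_residual mX mN mf i.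
apply: square_integrable_integrable => //.
apply: le_integrable (residual_sqr_integrable mX mN mf loss) => //.
  by apply/measurable_EFinP; exact: measurable_funX.
move=> w _; rewrite /= lee_fin !ger0_norm ?sqr_ge0//; last first.
  by apply: sumr_ge0 => j _; exact: sqr_ge0.
by rewrite (bigD1 i)//= lerDl sumr_ge0// => j _; exact: sqr_ge0.
Qed.

(* First-order optimality: perturbing the minimizer by [c] times the indicator
   of [B] in the [i]-th coordinate changes the loss by [c^2 P(A) - 2 c I], where
   [A] is the preimage of [B] and [I] the integral of the residual on [A];
   taking [c = I] forces [I = 0]. *)
Lemma noise_loss_minimizer_residual X N f i A :
  random_vector X -> random_vector N -> standard_gaussian P N ->
  noise_loss_minimizer P X N f -> sigma_of X A ->
  (\int[P]_(w in A) (N w 0 i - f (X w) 0 i)%:E = 0)%E.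
Proof.
move=> mX mN gN f_opt sA; have mA : measurable A by exact: sub_sigma_of sA.
have loss := noise_loss_lty mX mN gN f_opt; have [mf f_min] := f_opt.
pose D j w := N w 0 j - f (X w) 0 j; pose S w := \sum_(j < d) D j w ^+ 2.
have iD : P.-integrable setT (EFin \o D i) by exact: residual_integrable.
have iS : P.-integrable setT (EFin \o S) by exact: residual_sqr_integrable.
have i1 : P.-integrable setT (EFin \o (\1_A : Omega -> R)).
  by apply: integrable_indic => //; rewrite ltey_eq fin_num_measure.
have iAD : P.-integrable setT (EFin \o (fun w => \1_A w * D i w)).
  apply: le_integrable iD => //.
    apply/measurable_EFinP; apply: measurable_funM => //.
    exact: random_vector_residual.
  move=> w _ /=; rewrite lee_fin normrM indicE.
  by case: (w \in A); rewrite ?normr1 ?normr0 ?mul1r ?mul0r.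
set I := \int[P]_w (\1_A w * D i w).
have I_le c : 2 * c * I <= c ^+ 2 * \int[P]_w (\1_A w).
  (* Since [A] is the preimage of [B] under [X], the perturbation depends on the observation only
     and [g] is an admissible competitor. *)
  move: (sA); rewrite sigma_ofE => -[B sB]; rewrite setTI => BA.
  pose g x := f x + (c * \1_B x) *: delta_mx 0 i.
  have mg : measurable_wrt (sigma_of id) g.
    apply/measurable_wrtP => j.
    have -> : coord g j = fun x => coord f j x + \1_B x * (c * (j == i)%:R).
      by apply/funext => x; rewrite /coord !mxE eqxx andTb mulrAC [_ * \1_B x]mulrC.
    apply: measurable_funD; first exact: (measurable_wrtP id f).1.
    apply: measurable_funM; last exact: measurable_cst.
    exact: measurable_indic.
  have := f_min g mg; rewrite /noise_loss.
  have -> : (fun w => (\sum_(j < d) (N w 0 j - g (X w) 0 j) ^+ 2)%:E) =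
      (fun w => (S w - (2 * c * (\1_A w * D i w) - c ^+ 2 * \1_A w))%:E).
    apply/funext => w; congr EFin; rewrite /S (bigD1 i)//= [in RHS](bigD1 i)//=.
    have -> : \1_A w = \1_B (X w) :> R.
      by rewrite -BA !indicE; congr (_ %:R); apply/idP/idP; rewrite !inE.
    have -> : \sum_(j < d | j != i) (N w 0 j - g (X w) 0 j) ^+ 2 =
        \sum_(j < d | j != i) D j w ^+ 2.
      apply: eq_bigr => j /negbTE ji.
      by rewrite /g !mxE eqxx ji mulr0 addr0.
    rewrite /g !mxE !eqxx mulr1 /D /= indicE.
    by case: (_ \in B) => /=; ring.
  pose h w := 2 * c * (\1_A w * D i w) - c ^+ 2 * \1_A w.
  have i2 : P.-integrable setT (EFin \o (fun w => 2 * c * (\1_A w * D i w))).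
    exact: (integrableZl measurableT (2 * c) iAD).
  have i3 : P.-integrable setT (EFin \o (fun w => c ^+ 2 * \1_A w)).
    exact: (integrableZl measurableT (c ^+ 2) i1).
  have ih : P.-integrable setT (EFin \o h) by exact: (integrableB measurableT i2 i3).
  have iSh : P.-integrable setT (EFin \o (fun w => S w - h w)).
    exact: (integrableB measurableT iS ih).
  (* Both losses are finite, so the integral of [S] cancels from the inequality. *)
  rewrite (EFin_Rintegral iS) (EFin_Rintegral iSh) lee_fin RintegralB//.
  rewrite lerBrDl gerDr /h RintegralB// RintegralZl// RintegralZl//.
  by rewrite subr_le0.
have P1 : \int[P]_w (\1_A w) <= 1 :> R.
  rewrite -lee_fin -EFin_Rintegral// integral_indic// setIT.
  exact: probability_le1.
have I0 : I = 0.
  (* The bound reads [2 * I ^+ 2 <= I ^+ 2 * P A], and [P A <= 1] leaves [I ^+ 2 <= 0]. *)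
  have := I_le I; have := sqr_ge0 I; move: P1; rewrite !expr2 => P1 I2 I2p.
  suff : I * I <= 0 by move=> I3; apply/eqP; rewrite -sqrf_eq0 expr2 eq_le I3 I2.
  by nra.
rewrite integral_mkcond; transitivity I%:E; last by rewrite I0.
rewrite /I -EFin_Rintegral//.
apply: eq_integral => w _; rewrite patchE indicE.
by case: (w \in A); rewrite ?mul1r ?mul0r.
Qed.

End noise_prediction.

(** * The posterior mean as a conditional expectation *)

Section posterior_mean.
Context {R : realType} {d : nat} {disp : measure_display}.
Context {Omega : measurableType disp} (P : probability Omega R).

Lemma ddim_posterior_mean_cond_expectation (beta : R -> R)
    (eps : 'rV[R]_d -> R -> 'rV[R]_d) (t : R)
    (x0 noise xt : Omega -> 'rV[R]_d) :
  random_vector x0 -> integrable_vector P x0 ->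
  random_vector noise -> standard_gaussian P noise ->
  (forall w, xt w = Num.sqrt (alpha beta t) *: x0 w
                    + Num.sqrt (1 - alpha beta t) *: noise w) ->
  noise_loss_minimizer P xt noise (eps ^~ t) ->
  is_cond_expectation P x0 xt (fun w => ddim_posterior_mean beta eps (xt w) t).
Proof.
move=> mx0 ix0 mN gN xtE f_opt; have [mf _] := f_opt.
set a := Num.sqrt (alpha beta t) in xtE *; set b := Num.sqrt _ in xtE *.
have a0 : a != 0 by rewrite gt_eqF// sqrtr_gt0 expR_gt0.
have mX : random_vector xt.
  apply/random_vectorP => i.
  have -> : coord xt i = fun w => a * coord x0 i w + b * coord noise i w.
    by apply/funext => w; rewrite /coord xtE !mxE.
  by apply: measurable_funD; apply: measurable_funM => //;
    [move/random_vectorP: mx0; exact|move/random_vectorP: mN; exact].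
pose D i w := noise w 0 i - eps (xt w) t 0 i.
set Z := (fun w => _).
have ZE i : coord Z i = fun w => coord x0 i w + a^-1 * b * D i w.
  apply/funext => w; rewrite /Z /ddim_posterior_mean -/a -/b /D /coord !mxE.
  by rewrite xtE !mxE; field.
have loss := noise_loss_lty mX mN gN f_opt.
have iD i : P.-integrable setT (EFin \o D i).
  exact: residual_integrable i mX mN mf loss.
have icD i : P.-integrable setT (EFin \o (fun w => a^-1 * b * D i w)).
  exact: (integrableZl measurableT (a^-1 * b) (iD i)).
split.
- apply/measurable_wrtP => i.
  (* Measurability is read off the formula in [xt]; [ZE] involves [x0] and the noise, which need not
     be measurable for [sigma_of xt]. *)
  have -> : coord Z i = fun w => a^-1 * (coord xt i w - b * coord (eps ^~ t \o xt) i w).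
    by apply/funext => w; rewrite /Z /ddim_posterior_mean /coord !mxE.
  apply: measurable_funM; first exact: measurable_cst.
  apply: measurable_funB; first exact: (measurable_wrtP xt xt).1 (@measurable_wrt_gen _ _ _ xt) i.
  apply: measurable_funM; first exact: measurable_cst.
  exact: (measurable_wrtP xt _).1 (measurable_wrt_comp mf) i.
- by move=> i; rewrite ZE; exact: (integrableD measurableT (ix0 i) (icD i)).
- move=> i A sA; have mA : measurable A by exact: sub_sigma_of sA.
  rewrite ZE; under eq_integral do rewrite EFinD.
  have subA h : P.-integrable setT h -> P.-integrable A h by exact: integrableS.
  rewrite (integralD mA (subA _ (ix0 i)) (subA _ (icD i))).
  rewrite -[RHS]adde0; congr (_ + _)%E.
  transitivity ((a^-1 * b)%:E * \int[P]_(w in A) (D i w)%:E)%E.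
    exact: (integralZl mA (subA _ (iD i))).
  by rewrite (noise_loss_minimizer_residual i mX mN gN f_opt sA) mule0.
Qed.

End posterior_mean.
Theorem mainTheorem2 (R : realType) (d : nat) (T : R) (beta : R -> R)
    (eps : 'rV[R]_d -> R -> 'rV[R]_d)
    (T_gt0 : 0 < T)
    (beta_cont : {within `[0, T], continuous beta})
    (beta_ge0 : {in `[0, T], forall s, 0 <= beta s})
    (t : R) (t_in : t \in `[0, T])
    (x xs : 'rV[R]_d)
    (xsE : xs = (Num.sqrt (alpha beta t))^-1 *: x) :
  (* the network input recovered from the scaled variable *)
  x = (Num.sqrt (1 + sigma beta t ^+ 2))^-1 *: xs /\
  (* the two expressions of the posterior mean estimate *)
  ddim_posterior_mean beta eps x t = xs - sigma beta t *: eps x t /\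
  (* it is the conditional expectation when the network is optimally trained *)
  (forall (disp : measure_display) (Omega : measurableType disp)
      (P : probability Omega R) (x0 noise xt : Omega -> 'rV[R]_d),
    random_vector x0 -> integrable_vector P x0 ->
    random_vector noise -> standard_gaussian P noise ->
    independent_vectors P x0 noise ->
    (forall w, xt w = Num.sqrt (alpha beta t) *: x0 w
                      + Num.sqrt (1 - alpha beta t) *: noise w) ->
    noise_loss_minimizer P xt noise (eps ^~ t) ->
    is_cond_expectation P x0 xt
      (fun w => ddim_posterior_mean beta eps (xt w) t)) /\
  (* sigma is an admissible independent variable on [0, T] *)
  sigma beta 0 = 0 /\
  {in `]0, T[, forall u, 0 < sigma beta u -> derivable (sigma beta) u 1} /\
  (exists clock, sigma_clock beta T t clock) /\
  (forall clock, sigma_clock beta T t clock ->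
    (* the PF-ODE, rewritten with sigma as independent variable *)
    (forall (y : R -> 'rV[R]_d) (u : R),
      u \in `]0, T[ -> 0 < sigma beta u < sigma beta T ->
      solves_at (pf_ode_sigma eps clock) y (sigma beta u) ->
      solves_at (pf_ode beta eps) (y \o sigma beta) u) /\
    (forall (y : R -> 'rV[R]_d) (s : R),
      s \in `]0, sigma beta T[ -> 0 < beta (clock s) ->
      solves_at (pf_ode beta eps) y (clock s) ->
      solves_at (pf_ode_sigma eps clock) (y \o clock) s) /\
    (* one explicit Euler step, from time t down to time 0 *)
    pf_ode_sigma eps clock (sigma beta t) xs = eps x t /\
    explicit_euler_step (pf_ode_sigma eps clock)
      (sigma beta t) (sigma beta 0) xs = ddim_posterior_mean beta eps x t).
Proof.
have xE : x = (Num.sqrt (1 + sigma beta t ^+ 2))^-1 *: xs.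
  rewrite (sqrt_1Dsigma_sqr beta_ge0 t_in) invrK xsE scalerA divff ?scale1r//.
  by rewrite gt_eqF// sqrtr_gt0 alpha_gt0.
have meanE : ddim_posterior_mean beta eps x t = xs - sigma beta t *: eps x t.
  rewrite /ddim_posterior_mean (sigma_alphaE beta_ge0 t_in) scalerBr scalerA.
  by rewrite xsE.
split; first exact: xE.
split; first exact: meanE.
split.
  move=> disp Omega P x0 noise xt mx0 ix0 mN gN _.
  exact: ddim_posterior_mean_cond_expectation.
split; first exact: sigma0.
split.
  move=> u uT su.
  by have [] := is_derive_sigma T_gt0 beta_cont beta_ge0 uT su.
split; first exact: sigma_clock_exists.
move=> clock clockP.
have slopeE : pf_ode_sigma eps clock (sigma beta t) xs = eps x t.
  (* The condition that [clock] selects [t] at its own level makes the network be evaluated at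
     [(x, t)]. *)
  by have [_ _ clockt] := clockP; rewrite /pf_ode_sigma clockt -xE.
split.
  move=> y u uT /andP[su _].
  exact: (pf_ode_of_sigma T_gt0 beta_cont beta_ge0 clockP uT su).
split; first exact: (pf_ode_to_sigma T_gt0 beta_cont beta_ge0 clockP).
split; first exact: slopeE.
by rewrite /explicit_euler_step slopeE sigma0 sub0r scaleNr meanE.
Qed.
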